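(* Let $n\geqslant 2$ be an integer and let $BS(1,n)\subset\mathrm{Homeo}_+(\mathbb{R})$ be the group generated by $a\colon x\mapsto nx$ and $b\colon x\mapsto x+1$. Let $f,h\in\mathrm{Homeo}_+(\mathbb{R})$, and suppose $f$ has compact support. Suppose there is a (not necessarily injective) group morphism $\phi\colon\langle BS(1,n),f\rangle\to\langle BS(1,n),h\rangle$ restricting to the identity on $BS(1,n)$ and mapping $f$ to $h$. Then either $h$ is a translation, or for all $x\in\mathbb{R}$ we have $h(x)\in\{x,f(x)\}$.
   Context: $\mathrm{Homeo}_+(\mathbb{R})$ is the group of orientation-preserving homeomorphisms of $\mathbb{R}$. $\langle BS(1,n),f\rangle$ denotes the subgroup of $\mathrm{Homeo}(\mathbb{R})$ generated by $BS(1,n)$ and $f$; likewise for $h$. The support of $f$ is the closure of $\{x\mid f(x)\neq x\}$. *)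

(* Defs.v *)
From HB Require Import structures.
From mathcomp Require Import all_boot all_order all_algebra.
From mathcomp Require Import all_classical all_reals all_analysis.
Import Order.TTheory GRing.Theory Num.Theory.
Import numFieldNormedType.Exports.

Set Implicit Arguments.
Unset Strict Implicit.
Unset Printing Implicit Defensive.

Local Open Scope classical_set_scope.
Local Open Scope ring_scope.

Section Homeo.
Variable T : topologicalType.

Definition homeomorphism (f : T -> T) : Prop :=
  exists g : T -> T, [/\ cancel f g, cancel g f, continuous f & continuous g].

Record homeo := Homeo {
  homeo_fun :> T -> T;
  homeo_subproof : `[< homeomorphism homeo_fun >] }.

HB.instance Definition _ := [isSub for homeo_fun].
HB.instance Definition _ := [Choice of homeo by <:].

Implicit Types f g : homeo.

Lemma homeoP f : homeomorphism f.
Proof. exact/asboolP/homeo_subproof. Qed.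

Lemma homeo_ext f g : f =1 g -> f = g.
Proof. by move=> /funext fg; apply/val_inj. Qed.

Definition homeo_inv_fun f : T -> T := projT1 (cid (homeoP f)).

Lemma homeo_inv_funP f :
  [/\ cancel f (homeo_inv_fun f), cancel (homeo_inv_fun f) f,
      continuous f & continuous (homeo_inv_fun f)].
Proof. exact: (projT2 (cid (homeoP f))). Qed.

Lemma homeo_one_subproof : `[< homeomorphism (@id T) >].
Proof. by apply/asboolP; exists id; split => // x; exact: cvg_id. Qed.

Lemma homeo_mul_subproof f g : `[< homeomorphism (f \o g) >].
Proof.
apply/asboolP; have [fK Kf cf cf'] := homeo_inv_funP f.
have [gK Kg cg cg'] := homeo_inv_funP g.
exists (homeo_inv_fun g \o homeo_inv_fun f); split.
- exact: can_comp.
- exact: can_comp.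
- by move=> x; apply: continuous_comp; [exact: cg|exact: cf].
- by move=> x; apply: continuous_comp; [exact: cf'|exact: cg'].
Qed.

Lemma homeo_inv_subproof f : `[< homeomorphism (homeo_inv_fun f) >].
Proof. by apply/asboolP; have [? ? ? ?] := homeo_inv_funP f; exists f; split. Qed.

Definition homeo_one := Homeo homeo_one_subproof.
Definition homeo_mul f g := Homeo (homeo_mul_subproof f g).
Definition homeo_inv f := Homeo (homeo_inv_subproof f).

Lemma homeo_mulA : associative homeo_mul.
Proof. by move=> f g h; exact: homeo_ext. Qed.

Lemma homeo_mul1 : left_id homeo_one homeo_mul.
Proof. by move=> f; exact: homeo_ext. Qed.

Lemma homeo_mulr1 : right_id homeo_one homeo_mul.
Proof. by move=> f; exact: homeo_ext. Qed.

Lemma homeo_mulV : left_inverse homeo_one homeo_inv homeo_mul.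
Proof. by move=> f; apply: homeo_ext => x /=; have [->] := homeo_inv_funP f. Qed.

Lemma homeo_mulrV : right_inverse homeo_one homeo_inv homeo_mul.
Proof. by move=> f; apply: homeo_ext => x /=; have [_ ->] := homeo_inv_funP f. Qed.

HB.instance Definition _ :=
  isGroup.Build homeo homeo_mulA homeo_mul1 homeo_mulr1 homeo_mulV homeo_mulrV.

Definition homeo_support f : set T := closure [set x | f x <> x].

End Homeo.

Section Generated.
Variable G : groupType.

Definition generated (A : set G) : set G :=
  smallest (fun H : set G => group_closed [in H]) A.

Lemma sub_generated (A : set G) : A `<=` generated A.
Proof. exact: sub_smallest. Qed.

Lemma generated_group_closed (A : set G) : group_closed [in generated A].
Proof.
split; first by rewrite inE => H [[H1 _] _]; rewrite inE in H1.
move=> u v; rewrite !inE => Au Av H HA.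
have [[_ HD] _] := HA.
by have := HD u v; rewrite !inE; apply; [exact: Au|exact: Av].
Qed.

Definition generated_type (A : set G) : Type := {x : G | x \in generated A}.

HB.instance Definition _ (A : set G) := SubChoice.on (generated_type A).
HB.instance Definition _ (A : set G) :=
  SubChoice_isSubGroup.Build G [in generated A] (generated_type A)
    (generated_group_closed A).

End Generated.

Section RealLine.
Variable R : realType.

(* A homeomorphism of the line preserves orientation iff it is increasing. *)
Definition orientation_preserving (f : homeo R) : Prop :=
  {homo f : x y / x < y}.

Lemma dilation_subproof (n : nat) (n2 : (2 <= n)%N) :
  `[< homeomorphism (fun x : R => n%:R * x) >].
Proof.
have n0 : n%:R != 0 :> R by rewrite pnatr_eq0 -lt0n (leq_trans _ n2).
apply/asboolP; exists (fun x => n%:R^-1 * x); split.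
- by move=> x; rewrite mulKf.
- by move=> x; rewrite mulVKf.
- by move=> x; exact: mulrl_continuous.
- by move=> x; exact: mulrl_continuous.
Qed.

Definition dilation (n : nat) (n2 : (2 <= n)%N) : homeo R :=
  Homeo (dilation_subproof n2).

Lemma translation_subproof (t : R) : `[< homeomorphism (fun x : R => x + t) >].
Proof.
apply/asboolP; exists (fun x => x - t); split.
- by move=> x; rewrite addrK.
- by move=> x; rewrite subrK.
- by move=> x; apply: cvgD; [exact: cvg_id|exact: cvg_cst].
- by move=> x; apply: cvgD; [exact: cvg_id|exact: cvg_cst].
Qed.

Definition translation (t : R) : homeo R := Homeo (translation_subproof t).

Definition BS1 (n : nat) (n2 : (2 <= n)%N) : set (homeo R) :=
  generated [set dilation n2; translation 1].

End RealLine.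

Arguments dilation R {n} n2.
Arguments BS1 R {n} n2.

(* Main.v *)
Require Import Defs.
From mathcomp Require Import all_boot all_order all_algebra.
From mathcomp Require Import all_classical all_reals all_analysis.
From mathcomp Require Import lra ring.
Import Order.TTheory GRing.Theory Num.Theory.
Import numFieldNormedType.Exports.
Local Open Scope classical_set_scope.
Local Open Scope ring_scope.

Set Implicit Arguments.
Unset Strict Implicit.
Unset Printing Implicit Defensive.

(** The conclusion holds in the sharper form that [h] is a translation or
[h = f].  Write [g_t] for the conjugate of [g] by the translation of length
[t].

Since [f] has compact support, [f] and [f_t] have disjoint supports, hence
commute, as soon as [|t|] is large.  Translations by [n]-adic rationals lie in
[BS(1,n)] and are fixed by the morphism, so [h] commutes with [h_t] for the same
[t], and by density for all real [t] with [|t|] large ([far_commute]).  This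
property alone leaves two cases.

If [h] has a fixed point, then [h] has bounded support
([far_commute_fixed]).  Indeed [h] preserves every far translate of its fixed
set, so moving a boundary point of this set by a displacement [h x - x], with
[x] far away, yields a boundary point again.  Boundary points fill no interval,
so the displacement is constant near each end of the line; a nonzero constant
would push fixed points out to where every point moves.

If [h] has no fixed point, compare [h] with [k = h_t] for large [t]
([far_commute_no_fixed]).  They commute, and each word in them satisfies the
property of [h] and commutes with [h]; if it has a fixed point it has bounded
support, hence is trivial because [h] moves that support to infinity.  So the
group generated by [h] and [k] acts freely on the line and is archimedean
ordered.  If [k <> h], some [k^m] lies below [h^(m-1)] or above [h^(m+1)]; then
the translation by [t], which conjugates [h] to [k], would fail to move some
point to the right by [t].  So [h_t = h] for all large [t], and [h] is a
translation.

In the case of a nontrivial [h] of bounded support, suppose [f x <> h x]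
([equal_of_local_commutation]).  Squeezing the support of [f] close to [x] by
an affine [g] in [BS(1,n)], the conjugate of [g f g^-1] by [f] is supported near
[f x], so it commutes with all [g' f g'^-1] supported near [h x].  Hence
[q = h (g h g^-1) h^-1] commutes with all [g' h g'^-1] supported near [h x].
These have arbitrarily small supports everywhere around [h x], so [q] fixes a
neighbourhood of [h x], where it is nontrivial: a contradiction. *)

(** * Displacement of a map that commutes with its far shifts *)

Lemma continuous_eps (R : realType) (r : R -> R) (x e : R) :
  continuous r -> 0 < e ->
  exists2 d, 0 < d & forall y, `|y - x| < d -> `|r y - r x| < e.
Proof.
move=> cr e0; have /cvgrPdist_lt/(_ e e0)/nbhs_ballP[d /= d0 dP] := cr x.
exists d => // y yd; rewrite distrC; apply: dP.
by rewrite /ball /= distrC.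
Qed.

Lemma continuous_IVT (R : realType) (r : R -> R) (a b v : R) :
  continuous r -> a <= b -> Num.min (r a) (r b) <= v <= Num.max (r a) (r b) ->
  exists2 c, a <= c <= b & r c = v.
Proof.
move=> cr ab hv; have [|c cab rc] := IVT ab _ hv.
  exact: continuous_subspaceT.
by exists c => //; move: cab; rewrite in_itv.
Qed.

(** Otherwise the fixed set would be open and closed in the connected line. *)
Lemma fixed_boundary (R : realType) (r : R -> R) (p q : R) :
  continuous r -> r p = p -> r q <> q ->
  exists2 a, r a = a & forall e, 0 < e -> exists2 z, `|z - a| < e & r z <> z.
Proof.
move=> cr rp rq; apply: contrapT => nb.
have opF : open [set x | r x = x].
  rewrite openE => a /= ra; apply: contrapT => nint; apply: nb.
  exists a => // e e0; apply: contrapT => nz; apply: nint.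
  apply/nbhs_ballP; exists e => // z az /=; apply: contrapT => rz.
  by apply: nz; exists z => //; rewrite distrC.
have clF : closed [set x | r x = x].
  have -> : [set x | r x = x] = (fun x => r x - x) @^-1` [set 0].
    by apply/seteqP; split => x /=; [move=> ->; rewrite subrr|move/subr0_eq].
  apply: preimage_closed; last exact: closed_eq.
  by move=> x _; apply: (@cvgB _ R^o); [exact: cr|exact: cvg_id].
suff FT : [set x | r x = x] = [set: R] by apply: rq; have : [set x | r x = x] q by rewrite FT.
have cT : connected [set: R] by exact/connected_intervalP.
apply: cT; first by exists p.
  by exists [set x | r x = x]; rewrite ?setTI.
by exists [set x | r x = x]; rewrite ?setTI.
Qed.

(** Stated on bare functions rather than homeomorphisms, so that it applies
directly to the reflected map [x |-> - r (- x)]. *)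
Definition commutes_far_shifts (R : realType) (r : R -> R) (L : R) : Prop :=
  forall t, L < `|t| -> forall x, r (r (x - t) + t) = r (r x - t) + t.

(** The shift of [r] by [x - a] fixes [x], hence also [r x], because [r] commutes
with it. *)
Lemma fixed_add_displacement (R : realType) (r : R -> R) (L a x : R) :
  commutes_far_shifts r L -> L < `|x - a| -> r a = a ->
  r (a + (r x - x)) = a + (r x - x).
Proof.
move=> rL xa ra; have := rL _ xa x.
have -> : x - (x - a) = a by lra.
have -> : r x - (x - a) = a + (r x - x) by lra.
have -> : r a + (x - a) = x by lra.
by lra.
Qed.

(** Pull back by [r]: a neighbourhood of fixed points around [a + (r x - x)] would
give one around [a]. *)
Lemma add_displacement_boundary (R : realType) (r : R -> R) (L a x e : R) :
  continuous r -> injective r -> commutes_far_shifts r L -> L < `|x - a| ->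
  (forall d, 0 < d -> exists2 z, `|z - a| < d & r z <> z) ->
  0 < e -> exists2 z, `|z - (a + (r x - x))| < e & r z <> z.
Proof.
move=> cr ir rL xa ba e0; have [d d0 dP] := continuous_eps x cr e0.
have [z za rz] := ba d d0; exists (r (z + (x - a)) - (x - a)).
  have -> : r (z + (x - a)) - (x - a) - (a + (r x - x)) = r (z + (x - a)) - r x.
    by lra.
  apply: dP; have -> : z + (x - a) - x = z - a by lra.
  exact: za.
move=> rfix; apply: rz; have := rL _ xa (z + (x - a)).
by rewrite rfix subrK addrK => /ir; lra.
Qed.

(** If the displacement took two values at far points, its intermediate values
would fill an interval of fixed points around one that is a boundary point. *)
Lemma displacement_constant (R : realType) (r : R -> R) (L a x y : R) :
  continuous r -> injective r -> commutes_far_shifts r L -> r a = a ->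
  (forall d, 0 < d -> exists2 z, `|z - a| < d & r z <> z) ->
  x <= y -> (forall w, x <= w <= y -> L < `|w - a|) -> r x - x = r y - y.
Proof.
move=> cr ir rL ra ba xy far; set u := fun w => r w - w.
have cu : continuous u by move=> w; apply: cvgB; [exact: cr|exact: cvg_id].
rewrite -/(u x) -/(u y); apply/eqP/negP => /negP uxy.
have e0 : 0 < `|u x - u y| / 2 by rewrite divr_gt0 // normr_gt0 subr_eq0.
have [w /far wa uw] : exists2 w, x <= w <= y & u w = (u x + u y) / 2.
  apply: continuous_IVT => //.
  by rewrite /Num.min /Num.max; case: ltP => ?; apply/andP; split; lra.
have [z + rz] := add_displacement_boundary cr ir rL wa ba e0.
rewrite -/(u w) uw => zw; apply: rz.
have [v /far va uv] : exists2 v, x <= v <= y & u v = z - a.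
  apply: continuous_IVT => //; move: zw.
  rewrite ltr_norml => /andP[]; rewrite /Num.min /Num.max.
  have [uu|uu] := ltP (u x) (u y).
    by rewrite ltr0_norm; [move=> ? ?; apply/andP; split; lra|lra].
  by rewrite ger0_norm; [move=> ? ?; apply/andP; split; lra|lra].
have := fixed_add_displacement rL va ra.
by rewrite -/(u v) uv addrC subrK.
Qed.

(** The displacement is a constant [s] near infinity.  Adding [|s|] preserves the
fixed set, so unless [s = 0] a fixed point is pushed to where every point
moves by [s]. *)
Lemma fixed_near_pinfty (R : realType) (r : R -> R) (L a : R) :
  continuous r -> injective r -> 0 <= L -> commutes_far_shifts r L -> r a = a ->
  (forall d, 0 < d -> exists2 z, `|z - a| < d & r z <> z) ->
  forall x, a + L < x -> r x = x.
Proof.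
move=> cr ir L0 rL ra ba; set s := r (a + L + 1) - (a + L + 1).
have us x : a + L < x -> r x = x + s.
  move=> xL; suff : r x - x = s by lra.
  case: (lerP (a + L + 1) x) => xa.
    apply/esym; apply: (displacement_constant cr ir rL ra ba) => // w /andP[? ?].
    by rewrite gtr0_norm; lra.
  apply: (displacement_constant cr ir rL ra ba) => [|w /andP[? ?]]; first lra.
  by rewrite gtr0_norm; lra.
have addF p : r p = p -> r (p + `|s|) = p + `|s|.
  move=> rp; set y := Num.max (a + L) (p + L + `|s|) + 1.
  have ya : a + L < y by rewrite ltr_pwDr // le_max lexx.
  have yp : p + L + `|s| < y by rewrite ltr_pwDr // le_max lexx orbT.
  have sle : s <= `|s| by exact: ler_norm.
  have nsle : - s <= `|s| by rewrite -normrN ler_norm.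
  (* For s < 0 the shift is read backwards: it fixes r y, hence y. *)
  have := us y ya => ry; case: (lerP 0 s) => s0.
    rewrite (ger0_norm s0) in yp *.
    have yp' : L < `|y - p| by rewrite gtr0_norm; lra.
    have := fixed_add_displacement rL yp' rp; rewrite ry.
    by have -> : p + (y + s - y) = p + s by lra.
  rewrite (ltr0_norm s0) in yp *.
  have far : L < `|y + s - p| by rewrite gtr0_norm; lra.
  have := rL _ far y; rewrite ry.
  have -> : y + s - (y + s - p) = p by lra.
  have -> : y - (y + s - p) = p - s by lra.
  rewrite rp; have -> : p + (y + s - p) = r y by lra.
  by move=> /ir; lra.
have aj (j : nat) : r (a + `|s| *+ j) = a + `|s| *+ j.
  elim: j => [|j IH]; first by rewrite mulr0n addr0.
  by rewrite mulrSr addrA; exact: addF.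
have [s0|s0] := eqVneq s 0; first by move=> x /us ->; rewrite s0 addr0.
have sp : 0 < `|s| by rewrite normr_gt0.
have [j _ jL] : exists2 j : nat, True & L < `|s| *+ j.
  exists (Num.trunc (L / `|s|)).+1 => //.
  rewrite -mulr_natl -ltr_pdivrMr //; exact: truncnS_gt.
have := us (a + `|s| *+ j); rewrite aj => /(_ _); rewrite ltrD2l => /(_ jL).
by move=> /eqP; rewrite -subr_eq0 opprD addrA subrr sub0r oppr_eq0 (negbTE s0).
Qed.

Lemma fixed_outside_bounded (R : realType) (r : R -> R) (L p : R) :
  continuous r -> injective r -> 0 <= L -> commutes_far_shifts r L -> r p = p ->
  exists M, forall x, M < `|x| -> r x = x.
Proof.
move=> cr ir L0 rL rp; have [[q rq]|nq] := pselect (exists q, r q <> q); last first.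
  by exists 0 => x _; apply: contrapT => rx; apply: nq; exists x.
have [a ra ba] := fixed_boundary cr rp rq.
exists (`|a| + L) => x; rewrite ltr_normr => /orP[xL|xL].
  apply: (fixed_near_pinfty cr ir L0 rL ra ba).
  by have := ler_norm a; lra.
pose r' y := - r (- y).
suff : r' (- x) = - x by rewrite /r' opprK => /oppr_inj.
apply: (@fixed_near_pinfty _ r' L (- a)) => //.
- move=> y; apply: (@cvgN _ R^o); apply: (@continuous_comp _ _ _ -%R r).
    by apply: (@cvgN _ R^o); exact: cvg_id.
  exact: cr.
- by move=> y z /oppr_inj/ir/oppr_inj.
- move=> t tL y; rewrite /r' !opprD !opprK.
  have tL' : L < `|- t| by rewrite normrN.
  by have := rL _ tL' (- y); rewrite !opprK => ->; rewrite opprB addrC.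
- by rewrite /r' opprK ra.
- move=> d /ba[z za rz]; exists (- z); first by rewrite -opprB normrN opprK addrC.
  by rewrite /r' opprK => /oppr_inj.
- by have := ler_norm (- a); rewrite normrN; lra.
Qed.

(** * Homeomorphisms commuting with their far shifts *)

Lemma homeo_continuous (R : realType) (g : homeo R) : continuous g.
Proof. by have [u [_ _ cg _]] := homeoP g. Qed.

Lemma homeoVK (R : realType) (g : homeo R) : cancel (g^-1)%g g.
Proof. by move=> x; have [_ gK _ _] := homeo_inv_funP g; exact: gK. Qed.

Lemma homeoK (R : realType) (g : homeo R) : cancel g (g^-1)%g.
Proof. by move=> x; have [gK _ _ _] := homeo_inv_funP g; exact: gK. Qed.

Lemma homeo_inj (R : realType) (g : homeo R) : injective g.
Proof. exact: can_inj (homeoK g). Qed.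

Lemma commute_app (R : realType) (u v : homeo R) (x : R) :
  commute u v -> u (v x) = v (u x).
Proof. by move=> uv; rewrite -[LHS]/((u * v)%g x) uv. Qed.

Lemma increasing_le (R : realType) (g : homeo R) x y :
  orientation_preserving g -> (g x <= g y) = (x <= y).
Proof. by move=> gi; exact: (le_mono gi). Qed.

Lemma increasingV (R : realType) (g : homeo R) :
  orientation_preserving g -> orientation_preserving (g^-1)%g.
Proof.
move=> gi x y xy; rewrite ltNge -(increasing_le _ _ gi) !homeoVK -ltNge //.
Qed.

Lemma increasingM (R : realType) (g k : homeo R) :
  orientation_preserving g -> orientation_preserving k ->
  orientation_preserving (g * k)%g.
Proof. by move=> gi ki x y /ki/gi. Qed.

Lemma increasingX (R : realType) (g : homeo R) m :
  orientation_preserving g -> orientation_preserving (g ^+ m)%g.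
Proof.
by move=> gi; elim: m => [|m IH] //; rewrite expgS; exact: increasingM.
Qed.

Lemma translationD (R : realType) (s t : R) :
  (translation s * translation t)%g = translation (t + s).
Proof. by apply: homeo_ext => x /=; rewrite addrA. Qed.

Lemma translationV (R : realType) (t : R) :
  ((translation t)^-1)%g = translation (- t).
Proof.
apply: homeo_ext => x; apply: (@homeo_inj _ (translation t)).
by rewrite homeoVK /= subrK.
Qed.

(** The conjugate of [g] by the translation of length [t]; with the convention
[u ^ v = v^-1 u v], the conjugating element is the inverse translation. *)
Definition shift_conj (R : realType) (g : homeo R) (t : R) : homeo R :=
  (g ^ (translation (- t)))%g.

Lemma shift_conjE (R : realType) (g : homeo R) t x :
  shift_conj g t x = g (x - t) + t.
Proof. by rewrite /shift_conj conjgE translationV opprK. Qed.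

Lemma shift_conjD (R : realType) (g : homeo R) s t :
  shift_conj (shift_conj g t) s = shift_conj g (t + s).
Proof. by apply: homeo_ext => x; rewrite !shift_conjE -addrA; congr (g _ + _); lra. Qed.

Lemma shift_conj_increasing (R : realType) (g : homeo R) t :
  orientation_preserving g -> orientation_preserving (shift_conj g t).
Proof. by move=> gi x y xy; rewrite !shift_conjE ltrD2r; apply: gi; rewrite ltrD2r. Qed.

Lemma commute_shift_conj (R : realType) (u v : homeo R) t :
  commute u v -> commute (shift_conj u t) (shift_conj v t).
Proof. by rewrite /commute /shift_conj -!conjMg => ->. Qed.

Definition far_commute (R : realType) (g : homeo R) : Prop :=
  exists2 L : R, 0 <= L & forall t, L < `|t| -> commute g (shift_conj g t).

Lemma far_commute_fixed (R : realType) (r : homeo R) p :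
  far_commute r -> r p = p -> exists M, forall x, M < `|x| -> r x = x.
Proof.
move=> [L L0 rL] rp; apply: (fixed_outside_bounded _ _ L0 _ rp).
- exact: homeo_continuous.
- exact: homeo_inj.
- by move=> t tL x; have := commute_app x (rL t tL); rewrite !shift_conjE.
Qed.

Lemma far_commuteV (R : realType) (g : homeo R) :
  far_commute g -> far_commute (g^-1)%g.
Proof.
move=> [L L0 gL]; exists L => // t /gL gt; rewrite /shift_conj conjVg.
by apply: commuteV; apply: commute_sym; apply: commuteV; exact: commute_sym.
Qed.

(** The supremum of a bounded orbit would have its preimage strictly to its
left, hence below some point of the orbit, whose image would exceed the
supremum. *)
Lemma orbit_unbounded (R : realType) (d : homeo R) (x M : R) :
  orientation_preserving d -> (forall y, y < d y) -> exists m, M < (d ^+ m)%g x.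
Proof.
move=> di dlt; apply: contrapT => nM.
have ub m : (d ^+ m)%g x <= M.
  by rewrite leNgt; apply/negP => Mm; apply: nM; exists m.
pose S := range (fun m => (d ^+ m)%g x).
have hS : has_sup S by split; [exists x, 0%N|exists M => _ [m _ <-]].
have lt : (d^-1)%g (sup S) < sup S.
  by have := dlt ((d^-1)%g (sup S)); rewrite homeoVK.
have e0 : 0 < sup S - (d^-1)%g (sup S) by rewrite subr_gt0.
have [_ [m _ <-]] := sup_adherent e0 hS; rewrite subKr => lem.
have := di _ _ lem; rewrite homeoVK ltNge => /negP; apply.
by apply: ub_le_sup; [case: hS|exists m.+1 => //; rewrite expgS].
Qed.

Lemma no_crossing (R : realType) (u v : homeo R) x :
  (forall y, u y = v y -> u = v) -> u x <= v x -> forall y, u y <= v y.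
Proof.
move=> uv ux y; rewrite leNgt; apply/negP => vy.
suff [c uc] : exists c, u c = v c by move: vy; rewrite (uv c uc) ltxx.
pose f z := u z - v z.
have cf : continuous f.
  by move=> z; apply: (@cvgB _ R^o); exact: homeo_continuous.
have fx : f x <= 0 by rewrite subr_le0.
have fy : 0 <= f y by rewrite subr_ge0 ltW.
have [xy|/ltW yx] := leP x y.
  have [|c _ fc] := @continuous_IVT _ f x y 0 cf xy; last by exists c; exact/subr0_eq.
  by rewrite ge_min le_max fx fy ?orbT.
have [|c _ fc] := @continuous_IVT _ f y x 0 cf yx; last by exists c; exact/subr0_eq.
by rewrite ge_min le_max fx fy ?orbT.
Qed.

(** The set of points moved by [r] is bounded and invariant under [h], whose orbits
are unbounded. *)
Lemma far_commute_free (R : realType) (h r : homeo R) p :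
  orientation_preserving h -> (forall x, x < h x) -> commute r h ->
  far_commute r -> r p = p -> r = 1%g.
Proof.
move=> hi hlt rh rfar /(far_commute_fixed rfar)[M rM]; apply: homeo_ext => x.
have [m mM] := orbit_unbounded x M hi hlt.
apply: (@homeo_inj _ (h ^+ m)%g); rewrite -(commute_app _ (commuteX m rh)).
by rewrite rM // (lt_le_trans mM) // ler_norm.
Qed.

(** When [s] is large, [h] and [k] commute with [h_s] and [k_s], because each of the
four pairs is a translate of a pair [h], [h_u] with [u] one of [s - t], [s], [s + t].
Words are written as left quotients of positive ones, to avoid integer
exponents. *)
Lemma far_commute_word (R : realType) (h : homeo R) (L t : R) (a b c d : nat) :
  0 <= L -> (forall s, L < `|s| -> commute h (shift_conj h s)) ->
  let k := shift_conj h t in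
  far_commute ((h ^+ c * k ^+ d)^-1 * (h ^+ a * k ^+ b))%g.
Proof.
move=> L0 hL k; exists (L + `|t|) => [|s sL]; first by rewrite addr_ge0.
have sle := ler_norm s; have nsle := ler_norm (- s).
have tle := ler_norm t; have ntle := ler_norm (- t).
rewrite !normrN in nsle ntle.
have st (e : R) : `|e| <= `|t| -> commute h (shift_conj h (s + e)).
  move=> et; apply: hL; have := ler_normD (s + e) (- e).
  by rewrite addrK normrN; lra.
have hh : commute h (shift_conj h s) by have := st 0; rewrite normr0 addr0; apply.
have hk : commute h (shift_conj k s) by rewrite shift_conjD addrC; exact: st.
have kh : commute k (shift_conj h s).
  have -> : shift_conj h s = shift_conj (shift_conj h (s - t)) t.
    by rewrite shift_conjD subrK.
  by apply: commute_shift_conj; apply: st; rewrite normrN.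
have kk : commute k (shift_conj k s).
  have -> : shift_conj k s = shift_conj (shift_conj h s) t.
    by rewrite !shift_conjD addrC.
  exact: commute_shift_conj.
have cw (u x y : homeo R) : commute u x -> commute u y ->
    commute u ((x ^+ c * y ^+ d)^-1 * (x ^+ a * y ^+ b))%g.
  move=> ux uy; apply: commuteM; last by apply: commuteM; exact: commuteX.
  by apply: commuteV; apply: commuteM; exact: commuteX.
rewrite /shift_conj conjMg conjVg !conjMg !conjXg.
by apply/cw; apply: commute_sym; apply/cw; exact: commute_sym.
Qed.

Lemma le_iterates (R : realType) (u v : homeo R) m y :
  orientation_preserving u -> (forall x, u x <= v x) ->
  (u ^+ m)%g y <= (v ^+ m)%g y.
Proof.
move=> ui uv; elim: m => [|m IH] //; rewrite !expgS.
rewrite -[leLHS]/(u ((u ^+ m)%g y)) -[leRHS]/(v ((v ^+ m)%g y)).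
by apply: le_trans (uv _); rewrite increasing_le.
Qed.

(** Freeness makes the group generated by [h] and [k] totally ordered by the values
at any single point.  If [k <> h], the archimedean property separates the
translation number of [k] from that of [h] by a factor.  Then [x |-> x + t],
which carries [h] to [k], scales translation numbers by a factor different from
[1]; like an affine map of slope different from [1], it cannot move every point
to the right. *)
Lemma far_commute_no_fixed (R : realType) (h : homeo R) (L t : R) :
  orientation_preserving h -> (forall x, x < h x) ->
  0 <= L -> (forall s, L < `|s| -> commute h (shift_conj h s)) -> L < t ->
  shift_conj h t = h.
Proof.
move=> hi hlt L0 hL tL; set k := shift_conj h t.
have hk : commute h k by apply: hL; rewrite gtr0_norm //; lra.
have ki : orientation_preserving k by exact: shift_conj_increasing.
have t0 : 0 < t by exact: le_lt_trans tL.
have Tk x : h x + t = k (x + t) by rewrite shift_conjE addrK.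
have TX m x : (h ^+ m)%g x + t = (k ^+ m)%g (x + t).
  elim: m x => [|m IH] x //; rewrite !expgS.
  by rewrite -[RHS]/(k ((k ^+ m)%g _)) -IH -Tk.
have kX m i : commute (h ^+ m)%g (k ^+ i)%g by exact: commuteX2.
have free a b c d x : (h ^+ a * k ^+ b)%g x = (h ^+ c * k ^+ d)%g x ->
    (h ^+ a * k ^+ b = h ^+ c * k ^+ d)%g.
  move=> e; set u := (h ^+ a * k ^+ b)%g; set v := (h ^+ c * k ^+ d)%g.
  suff vu : (v^-1 * u)%g = 1%g by rewrite -(mulVKg v u) vu mulg1.
  apply: (@far_commute_free _ h _ x) => //.
  - apply: commute_sym; apply: commuteM; last first.
      by apply: commuteM; apply: commuteX.
    by apply: commuteV; apply: commuteM; apply: commuteX.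
  - exact: (far_commute_word t a b c d L0 hL).
  - by rewrite -[LHS]/((v^-1)%g (u x)) /u e homeoK.
have nc a b c d x : (h ^+ a * k ^+ b)%g x <= (h ^+ c * k ^+ d)%g x ->
    forall y, (h ^+ a * k ^+ b)%g y <= (h ^+ c * k ^+ d)%g y.
  by apply: no_crossing => y; exact: free.
have hunb x M := orbit_unbounded x M hi hlt.
have [j jt] := hunb 0 t.
have [[x kh]|kh] := pselect (exists x, k x = h x).
  by have := free 0%N 1%N 1%N 0%N x; rewrite !expg0 !expg1 mul1g mulg1; apply.
have [kh0|/ltW hk0] := leP (k 0) (h 0).
  have klt x : k x < h x.
    rewrite lt_neqAle; apply/andP; split; first by apply/eqP => e; apply: kh; exists x.
    by have := nc 0%N 1%N 1%N 0%N 0; rewrite !expg0 !expg1 mul1g mulg1; apply.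
  have dlt x : x < (k^-1 * h)%g x.
    by have := increasingV ki (klt x); rewrite homeoK.
  have [m] := orbit_unbounded 0 (h 0) (increasingM (increasingV ki) hi) dlt.
  rewrite expgMn; last by apply: commute_sym; exact: commuteV.
  rewrite expVgn => /(increasingX m ki).
  rewrite -[ltRHS]/((k ^+ m)%g ((k ^+ m)^-1%g _)) homeoVK => /ltW hm.
  have hkm y : (h * k ^+ m)%g y <= (h ^+ m)%g y.
    have := nc 1%N m m 0%N 0; rewrite expg1 expg0 mulg1; apply.
    by rewrite -[leLHS]/(h ((k ^+ m)%g 0)) (commute_app _ (commuteX m hk)).
  (* The translate by t of h^(m j) 0 is k^(m j) t, which lies left of
     k^(m j) (h^j 0) = (h k^m)^j 0, hence of h^(m j) 0 itself. *)
  have := le_iterates j 0 (increasingM hi (increasingX m ki)) hkm.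
  rewrite expgMn; last exact: commuteX.
  rewrite -!expgnA -[leLHS]/((h ^+ j)%g ((k ^+ (m * j))%g 0)).
  rewrite (commute_app _ (kX j (m * j)%N)) => le1.
  have := increasingX (m * j) ki jt; have := TX (m * j)%N 0; rewrite add0r => <-.
  by move=> /lt_le_trans/(_ le1); rewrite gtrDl => /(lt_trans t0); rewrite ltxx.
have hlk x : h x < k x.
  rewrite lt_neqAle; apply/andP; split; first by apply/eqP => e; apply: kh; exists x.
  by have := nc 1%N 0%N 0%N 1%N 0; rewrite !expg0 !expg1 mul1g mulg1; apply.
have dlt x : x < (h^-1 * k)%g x.
  by have := increasingV hi (hlk x); rewrite homeoK.
have [m] := orbit_unbounded 0 (h 0) (increasingM (increasingV hi) ki) dlt.
rewrite expgMn; last by apply: commute_sym; apply: commuteV; exact: commute_sym.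
rewrite expVgn => /(increasingX m hi).
rewrite -[ltRHS]/((h ^+ m)%g ((h ^+ m)^-1%g _)) homeoVK => /ltW hm.
have hkm y : (h ^+ m.+1)%g y <= (k ^+ m)%g y.
  by have := nc m.+1 0%N 0%N m 0; rewrite !expg0 mul1g mulg1; apply; rewrite expgSr.
have le1 y := le_iterates j y (increasingX m.+1 hi) hkm.
(* From y, t = h^(m j) y + t = k^(m j) (y + t) lies right of
   h^((m + 1) j) (y + t), hence of h^j 0. *)
set y := ((h ^+ (m * j))^-1)%g 0.
have y0 : (h ^+ (m * j))%g y = 0 by rewrite homeoVK.
have := le1 (y + t); rewrite -!expgnA -TX y0 add0r mulSn expgnDr.
have lt1 : (h ^+ (m * j))%g y < (h ^+ (m * j))%g (y + t).
  by apply: increasingX => //; lra.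
rewrite -[leLHS]/((h ^+ j)%g ((h ^+ (m * j))%g (y + t))) leNgt => /negP; case.
by apply: lt_trans jt _; apply: increasingX => //; rewrite -y0.
Qed.

(** Applying [h (x + t) = h x + t] at [x], and at [0] with [x + t] for [t], compares
[h x] with [h 0]. *)
Lemma commute_translations (R : realType) (h : homeo R) (L : R) :
  (forall t, L < t -> shift_conj h t = h) -> exists t, h = translation t.
Proof.
move=> hL; have hadd t x : L < t -> h (x + t) = h x + t.
  by move=> /hL ht; rewrite -{1}ht shift_conjE addrK.
exists (h 0); apply: homeo_ext => x /=.
pose t := `|L| + `|x| + 1.
have Lle := ler_norm L; have xle := ler_norm x; have nxle := ler_norm (- x).
rewrite normrN in nxle; have L0 := normr_ge0 L; have x0 := normr_ge0 x.
have := hadd t x; have := hadd (x + t) 0; rewrite add0r.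
have tL : L < t by rewrite /t; lra.
have xtL : L < x + t by rewrite /t; lra.
by move=> /(_ xtL) -> /(_ tL); lra.
Qed.

(** The displacement has constant sign; replace [h] by its inverse when it is
negative. *)
Lemma no_fixed_translation (R : realType) (h : homeo R) :
  orientation_preserving h -> far_commute h -> (forall x, h x <> x) ->
  exists t, h = translation t.
Proof.
move=> hi hfar nfix.
have case_up (g : homeo R) : orientation_preserving g -> far_commute g ->
    (forall x, x < g x) -> exists t, g = translation t.
  move=> gi [L L0 gL] glt; apply: (@commute_translations _ _ L) => t tL.
  exact: (far_commute_no_fixed gi glt L0 gL).
have cu : continuous (fun x => h x - x).
  by move=> x; apply: (@cvgB _ R^o); [exact: homeo_continuous|exact: cvg_id].
have same x y : x < h x -> y < h y.
  move=> hx; rewrite ltNge; apply/negP => hy.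
  suff [c hc] : exists c, h c - c = 0 by apply: (nfix c); exact/subr0_eq.
  have [xy|/ltW yx] := leP x y.
    have [|c _ hc] := @continuous_IVT _ _ x y 0 cu xy; last by exists c.
    rewrite ge_min le_max; apply/andP; split; apply/orP; [right|left]; lra.
  have [|c _ hc] := @continuous_IVT _ _ y x 0 cu yx; last by exists c.
  rewrite ge_min le_max; apply/andP; split; apply/orP; [left|right]; lra.
have [h0|h0] := ltP 0 (h 0).
  by apply: case_up => // x; exact: same h0.
have hlt x : x < (h^-1)%g x.
  rewrite ltNge -(increasing_le _ _ hi) homeoVK; apply/negP => xh.
  have : x < h x by rewrite lt_neqAle xh andbT; apply/eqP => e; exact: (nfix x).
  by move=> /same => /(_ 0); rewrite ltNge h0.
have [t ht] := case_up _ (increasingV hi) (far_commuteV hfar) hlt.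
by exists (- t); rewrite -translationV -ht invgK.
Qed.

(** * Transfer of commutation relations along a morphism *)

(** The graph of [phi], seen between the ambient groups: relations between elements
of the source pass to the target without handling membership proofs. *)
Definition matched (G : groupType) (A B : set G)
    (phi : generated_type A -> generated_type B) (u v : G) : Prop :=
  exists2 g : generated_type A, sval g = u & sval (phi g) = v.

Lemma matchedM (G : groupType) (A B : set G)
    (phi : {multiplicative generated_type A -> generated_type B}) u v u' v' :
  matched phi u v -> matched phi u' v' -> matched phi (u * u')%g (v * v')%g.
Proof.
move=> [g <- <-] [g' <- <-]; exists (g * g')%g => //.
by rewrite gmulfM.
Qed.

Lemma matchedV (G : groupType) (A B : set G)
    (phi : {multiplicative generated_type A -> generated_type B}) u v :
  matched phi u v -> matched phi u^-1%g v^-1%g.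
Proof.
move=> [g <- <-]; exists (g^-1)%g; first exact: (@gmulfV _ _ val g).
have phi1 : (phi 1 = 1)%g.
  by apply: (@mulIg _ (phi 1%g)); rewrite -gmulfM !mul1g.
have -> : (phi g^-1 = (phi g)^-1)%g.
  by apply: (@mulIg _ (phi g)); rewrite -gmulfM !mulVg phi1.
exact: (gmulfV (val : generated_type B -> G) (phi g)).
Qed.

Lemma matched_commute (G : groupType) (A B : set G)
    (phi : {multiplicative generated_type A -> generated_type B}) u v u' v' :
  matched phi u v -> matched phi u' v' -> commute u u' -> commute v v'.
Proof.
move=> [g <- <-] [g' <- <-] uu'.
have gg' : (g * g' = g' * g)%g by exact: val_inj.
have := congr1 (fun g => val (phi g)) gg'.
by rewrite /= !gmulfM.
Qed.

(** * Affine maps in BS(1,n) *)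

(** The affine map [x |-> (x + m) / n^k]. *)
Definition contraction (R : realType) (n : nat) (n2 : (2 <= n)%N) (k : nat) (m : int)
  : homeo R := ((dilation R n2)^-1 ^+ k * translation m%:~R)%g.

Lemma generatedM (G : groupType) (A : set G) u v :
  generated A u -> generated A v -> generated A (u * v)%g.
Proof.
move=> uA vA; have := group_closedM (generated_group_closed A).
by move=> /(_ u v); rewrite !inE; apply.
Qed.

Lemma generatedV (G : groupType) (A : set G) u :
  generated A u -> generated A u^-1%g.
Proof.
move=> uA; have /(_ u) := group_closedV (generated_group_closed A).
by rewrite !inE; apply.
Qed.

Lemma generated1 (G : groupType) (A : set G) : generated A 1%g.
Proof. by have [] := generated_group_closed A; rewrite inE. Qed.

Lemma generatedX (G : groupType) (A : set G) u m :
  generated A u -> generated A (u ^+ m)%g.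
Proof.
move=> uA; elim: m => [|m IH]; first exact: generated1.
by rewrite expgS; exact: generatedM.
Qed.

Lemma BS1_translation_int (R : realType) (n : nat) (n2 : (2 <= n)%N) (m : int) :
  BS1 R n2 (translation m%:~R).
Proof.
have nat_case (j : nat) : BS1 R n2 (translation j%:R).
  elim: j => [|j IH].
    suff -> : translation 0%:R = 1%g :> homeo R by exact: generated1.
    by apply: homeo_ext => x /=; rewrite addr0.
  rewrite -natr1 addrC -translationD; apply: generatedM => //.
  by apply: sub_generated; right.
case: m => j; first exact: nat_case.
by rewrite NegzE mulrNz -translationV; apply: generatedV; exact: nat_case.
Qed.

Lemma BS1_contraction (R : realType) (n : nat) (n2 : (2 <= n)%N) k m :
  BS1 R n2 (contraction R n2 k m).
Proof.
apply: generatedM; last exact: BS1_translation_int.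
by apply: generatedX; apply: generatedV; apply: sub_generated; left.
Qed.

Lemma dilationVE (R : realType) (n : nat) (n2 : (2 <= n)%N) k (x : R) :
  (((dilation R n2)^-1) ^+ k)%g x = x / n%:R ^+ k.
Proof.
have n0 : n%:R != 0 :> R by rewrite pnatr_eq0 -lt0n (leq_trans _ n2).
have V y : ((dilation R n2)^-1)%g y = y / n%:R.
  by apply: (@homeo_inj _ (dilation R n2)); rewrite homeoVK /= mulrC divfK.
elim: k x => [|k IH] x; first by rewrite expr0 divr1.
by rewrite expgS -[LHS]/(((dilation R n2)^-1)%g _) V IH exprSr invfM mulrA.
Qed.

Lemma contractionE (R : realType) (n : nat) (n2 : (2 <= n)%N) k m (x : R) :
  contraction R n2 k m x = (x + m%:~R) / n%:R ^+ k.
Proof. by rewrite -[LHS]/((((dilation R n2)^-1) ^+ k)%g (x + m%:~R)) dilationVE. Qed.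

(** The value at [0] is the [n]-adic rational [m / n^k]; dividing by the contraction
with [m = 0] leaves the translation by it. *)
Lemma BS1_translation_contraction (R : realType) (n : nat) (n2 : (2 <= n)%N) k m :
  BS1 R n2 (translation (contraction R n2 k m 0)).
Proof.
have n0 : n%:R ^+ k != 0 :> R by rewrite expf_neq0 // pnatr_eq0 -lt0n (leq_trans _ n2).
suff -> : translation (contraction R n2 k m 0) =
    (contraction R n2 k m * (contraction R n2 k 0)^-1)%g.
  by apply: generatedM; [|apply: generatedV]; exact: BS1_contraction.
apply: homeo_ext => x; set y := ((contraction R n2 k 0)^-1)%g x.
have <- : contraction R n2 k 0 y = x by rewrite homeoVK.
rewrite -[RHS]/(contraction R n2 k m (((contraction R n2 k 0)^-1)%g _)) homeoK.
rewrite -[LHS]/(contraction R n2 k 0 y + contraction R n2 k m 0) !contractionE.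
by field.
Qed.

Lemma contraction_near (R : realType) (n : nat) (n2 : (2 <= n)%N) (x e K : R) :
  0 < e -> exists k m, forall y, `|y| <= K -> `|contraction R n2 k m y - x| < e.
Proof.
move=> e0; pose k := (Num.trunc ((K + 1) / e)).+1.
(* Rounding x n^k costs at most 1, so the image is within (K + 1) / n^k of x. *)
exists k, (Num.floor (x * n%:R ^+ k)) => y yK.
have nk : (k%:R : R) <= n%:R ^+ k.
  by rewrite -natrX ler_nat ltnW // ltn_expl.
have k0 : 0 < k%:R :> R by rewrite ltr0n.
have nk0 : 0 < n%:R ^+ k :> R by apply: lt_le_trans nk.
have kKe : K + 1 < n%:R ^+ k * e.
  rewrite -ltr_pdivrMr //; apply: lt_le_trans nk; exact: truncnS_gt.
set m := Num.floor _; rewrite contractionE.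
have -> : (y + m%:~R) / n%:R ^+ k - x = (y + (m%:~R - x * n%:R ^+ k)) / n%:R ^+ k.
  by field; exact: lt0r_neq0.
rewrite normrM normfV (gtr0_norm nk0) ltr_pdivrMr // [ltRHS]mulrC.
apply: le_lt_trans kKe; apply: (le_trans (ler_normD _ _)); apply: lerD => //.
have := floor_itv (x * n%:R ^+ k); rewrite -/m => /andP[m1 m2].
by rewrite ler_norml; move: m1 m2; rewrite intrD; lra.
Qed.

(** * Relations between maps with disjoint supports *)

Lemma disjoint_commute (R : realType) (u v : homeo R) (A B : set R) :
  (forall x, ~ A x -> u x = x) -> (forall x, ~ B x -> v x = x) ->
  (forall x, A x -> ~ B x) -> commute u v.
Proof.
move=> uA vB AB; apply: homeo_ext => x.
rewrite -[LHS]/(u (v x)) -[RHS]/(v (u x)).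
have keep (w : homeo R) (C : set R) y : (forall x, ~ C x -> w x = x) -> C y -> C (w y).
  move=> wC Cy; apply: contrapT => nC.
  by have /homeo_inj e := wC _ nC; rewrite e in nC.
have [Ax|nAx] := pselect (A x).
  by rewrite (vB x (AB x Ax)) (vB (u x)) //; apply: AB; exact: keep.
rewrite (uA x nAx); have [Bx|nBx] := pselect (B x); last by rewrite (vB x nBx) uA.
by rewrite uA // => /AB; apply; exact: keep.
Qed.

Lemma conj_fixed_outside (R : realType) (f g : homeo R) (K : R) (P : set R) :
  (forall x, K < `|x| -> f x = x) -> (forall y, `|y| <= K -> P (g y)) ->
  forall z, ~ P z -> (g * f * g^-1)%g z = z.
Proof.
move=> fK gP z nP; rewrite -[LHS]/(g (f ((g^-1)%g z))) fK ?homeoVK //.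
by rewrite ltNge; apply/negP => /gP; rewrite homeoVK.
Qed.

Lemma bounded_support (R : realType) (f : homeo R) :
  compact (homeo_support f) -> exists K, forall x, K < `|x| -> f x = x.
Proof.
move=> /compact_bounded[M [_ MP]]; exists (M + 1) => x xM.
apply: contrapT => fx; have := MP (M + 1); rewrite ltrDl => /(_ ltr01 x) /=.
by rewrite leNgt xM => /(_ (subset_closure fx)).
Qed.

(** Closeness to a dense set [D] of translation lengths suffices because both sides
of the commutation relation depend continuously on the length; for [f] the relation
holds because the supports of [f] and of its far shifts are disjoint. *)
Lemma matched_far_commute (R : realType) (f h : homeo R) (K : R) (D : R -> Prop) :
  (forall x, K < `|x| -> f x = x) ->
  (forall t e, 0 < e -> exists2 s, D s & `|s - t| < e) ->
  (forall t, D t -> commute f (shift_conj f t) -> commute h (shift_conj h t)) ->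
  far_commute h.
Proof.
move=> fK dense fh; pose L := 2 * `|K|.
have Kle := ler_norm K.
exists L => [|t tL]; first by rewrite mulr_ge0.
have DL s : D s -> L < `|s| -> commute h (shift_conj h s).
  move=> Ds sL; apply: fh => //.
  apply: (@disjoint_commute _ _ _ [set x | `|x| <= K] [set x | `|x - s| <= K]).
  - by move=> x /= /negP; rewrite -ltNge => /fK.
  - by move=> x nx; rewrite shift_conjE fK ?subrK // ltNge; exact/negP.
  - move=> x /= xK xsK; have := ler_normD x (- (x - s)).
    by rewrite normrN opprB addrC subrK; move: sL; rewrite /L; lra.
apply: homeo_ext => x; rewrite -[LHS]/(h (shift_conj h t x)).
rewrite -[RHS]/(shift_conj h t (h x)) !shift_conjE.
pose F s := h (h (x - s) + s) - (h (h x - s) + s).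
apply/subr0_eq; rewrite -/(F t); apply/eqP/negP => /negP Ft.
have hc := @homeo_continuous _ h.
have cF : continuous F.
  move=> s.
  have c1 (y : R) : (fun s => h (y - s)) @ s --> h (y - s).
    apply: (@continuous_comp _ _ _ (fun s => y - s) h); last exact: hc.
    by apply: (@cvgB _ R^o); [exact: cvg_cst|exact: cvg_id].
  apply: (@cvgB _ R^o); last by apply: (@cvgD _ R^o); [exact: c1|exact: cvg_id].
  apply: (@continuous_comp _ _ _ (fun s => h (x - s) + s) h); last exact: hc.
  by apply: (@cvgD _ R^o); [exact: c1|exact: cvg_id].
have Ft0 : 0 < `|F t| by rewrite normr_gt0.
have [d d0 dP] := continuous_eps t cF Ft0.
have e0 : 0 < Num.min d (`|t| - L) by rewrite lt_min d0 subr_gt0.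
have [s Ds] := dense t _ e0; rewrite lt_min => /andP[/dP + st].
have sL : L < `|s|.
  have := ler_normD s (t - s); rewrite addrC subrK (distrC t); lra.
have := commute_app x (DL s Ds sL); rewrite !shift_conjE => e.
by rewrite {1}/F e subrr sub0r normrN ltxx.
Qed.

(** The set [C] stands for the affine maps of [BS(1,n)], which squeeze a bounded
interval into a neighbourhood of any given point.  If [f x] and [h x] differ,
conjugates of [f] squeezed near [h x] commute with the conjugate by [f] of one
squeezed near [x]; the same relation for [h] fails, since there both maps can be
supported around a common moved point near [h x]. *)
Lemma equal_of_local_commutation (R : realType) (f h : homeo R) (K y0 : R)
    (C : homeo R -> Prop) :
  (forall x, K < `|x| -> f x = x) -> (forall x, K < `|x| -> h x = x) ->
  h y0 <> y0 ->
  (forall x e, 0 < e -> exists2 g : homeo R, C g &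
    forall y, `|y| <= K -> `|g y - x| < e) ->
  (forall g g', C g -> C g' ->
    commute (f * (g * f * g^-1) * f^-1)%g (g' * f * g'^-1)%g ->
    commute (h * (g * h * g^-1) * h^-1)%g (g' * h * g'^-1)%g) ->
  forall x, h x = f x.
Proof.
move=> fK hK hy0 near fh x; apply/eqP/negP => /negP hfx.
have y0K : `|y0| <= K by rewrite leNgt; apply/negP => /hK.
pose e := `|h x - f x| / 2.
have e0 : 0 < e by rewrite divr_gt0 // normr_gt0 subr_eq0.
have [df df0 dfP] := continuous_eps x (@homeo_continuous _ f) e0.
have [dh dh0 dhP] := continuous_eps x (@homeo_continuous _ h) e0.
have d0 : 0 < Num.min df dh by rewrite lt_min df0.
have [g Cg gP] := near x _ d0.
pose A := [set z | `|z - f x| < e]; pose B := [set z | `|z - h x| < e].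
have AB z : A z -> ~ B z.
  rewrite /A /B /= => zA zB; have := ler_distD z (h x) (f x).
  by rewrite (distrC _ z); move: zA zB; rewrite /e; lra.
have wA z : ~ A z -> (f * (g * f * g^-1) * f^-1)%g z = z.
  move=> nA; rewrite -[LHS]/(f ((g * f * g^-1)%g ((f^-1)%g z))).
  rewrite (@conj_fixed_outside _ f g K [set y | `|y - x| < df]) ?homeoVK //.
    by move=> y /gP; rewrite lt_min => /andP[].
  by move=> /= /dfP; rewrite homeoVK.
(* q moves the point z = h (g y0) of B, but commutes with every conjugate of h
   squeezed inside B, which forces it to fix B pointwise. *)
set q := (h * (g * h * g^-1) * h^-1)%g in fh *.
pose z := h (g y0).
have qz : q z <> z.
  rewrite -[q z]/(h (g (h ((g^-1)%g ((h^-1)%g (h (g y0))))))) !homeoK.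
  by rewrite /z => /homeo_inj/homeo_inj.
have zB : B z by apply: dhP; have := gP _ y0K; rewrite lt_min => /andP[].
pose d := `|q z - z|.
have dp : 0 < d / 2 by rewrite divr_gt0 // normr_gt0 subr_eq0; exact/eqP.
have [dq dq0 dqP] := continuous_eps z (@homeo_continuous _ q) dp.
(* For r this small, the r-neighbourhood of z lies in B, and q carries each of its
   points outside it. *)
pose r := Num.min (Num.min dq (d / 2)) (e - `|z - h x|).
have r0 : 0 < r by rewrite !lt_min dq0 dp subr_gt0.
have [g' Cg' g'P] := near z r r0.
have w'B y : ~ B y -> (g' * f * g'^-1)%g y = y.
  apply: (@conj_fixed_outside _ f g' K B) => // v /g'P.
  rewrite !lt_min => /andP[_ vz]; rewrite /B /=.
  by have := ler_distD z (g' v) (h x); lra.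
have qp := fh g g' Cg Cg' (disjoint_commute wA w'B AB).
pose z' := g' y0.
have : (g' * h * g'^-1)%g (q z') <> q z'.
  rewrite -(commute_app z' qp) => /homeo_inj.
  rewrite -[X in X = _]/(g' (h ((g'^-1)%g (g' y0)))) homeoK.
  by move=> /homeo_inj.
apply; apply: (@conj_fixed_outside _ h g' K [set y | `|y - z| < r]) => // qz'B.
have : `|q z' - z| < r := qz'B; rewrite !lt_min => /andP[/andP[_ qz'z] _].
have := g'P _ y0K; rewrite !lt_min => /andP[/andP[/dqP qz'qz _] _].
have := ler_distD (q z') (q z) z; rewrite (distrC (q z) (q z')) -/d.
by move: qz'z qz'qz; rewrite -/z'; lra.
Qed.

(** * The dichotomy *)

Theorem proposition3p1 (R : realType) (n : nat) (n2 : (2 <= n)%N)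
    (f h : homeo R)
    (f_pos : orientation_preserving f) (h_pos : orientation_preserving h)
    (f_supp : compact (homeo_support f))
    (phi : {multiplicative generated_type (BS1 R n2 `|` [set f]) ->
                           generated_type (BS1 R n2 `|` [set h])})
    (phi_id : forall g : generated_type (BS1 R n2 `|` [set f]),
        BS1 R n2 (sval g) -> sval (phi g) = sval g)
    (phi_f : forall g : generated_type (BS1 R n2 `|` [set f]),
        sval g = f -> sval (phi g) = h) :
  (exists t : R, h = translation t) \/ (forall x : R, h x = x \/ h x = f x).
Proof.
have mBS c : BS1 R n2 c -> matched phi c c.
  move=> cBS; have cG : c \in generated (BS1 R n2 `|` [set f]).
    by rewrite inE; apply: sub_generated; left.
  by exists (exist _ c cG) => //; exact: phi_id.
have mf : matched phi f h.
  have fG : f \in generated (BS1 R n2 `|` [set f]).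
    by rewrite inE; apply: sub_generated; right.
  by exists (exist _ f fG) => //; exact: phi_f.
have mconj c : BS1 R n2 c -> matched phi (c * f * c^-1)%g (c * h * c^-1)%g.
  by move=> cBS; apply: matchedM; [apply: matchedM|apply: matchedV]; auto.
have [K fK] := bounded_support f_supp.
have hfar : far_commute h.
  apply: (@matched_far_commute _ f h K (fun t => BS1 R n2 (translation t))) => //.
    move=> t e e0; have [k [m km]] := contraction_near n2 t 0 e0.
    exists (contraction R n2 k m 0); first exact: BS1_translation_contraction.
    by apply: km; rewrite normr0.
  move=> t tBS; apply: matched_commute; first exact: mf.
  by rewrite /shift_conj !conjgE !mulgA -!translationV invgK; exact: mconj.
have [[p hp]|nfix] := pselect (exists p, h p = p); last first.
  by left; apply: no_fixed_translation => // x hx; apply: nfix; exists x.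
have [M hM] := far_commute_fixed hfar hp.
have [[y hy]|h1] := pselect (exists y, h y <> y); last first.
  left; exists 0; apply: homeo_ext => x /=; rewrite addr0.
  by apply: contrapT => hx; apply: h1; exists x.
right => x; right; move: x.
apply: (@equal_of_local_commutation _ f h (Num.max K M) y (BS1 R n2)) => //.
- by move=> x; rewrite gt_max => /andP[/fK].
- by move=> x; rewrite gt_max => /andP[_ /hM].
- move=> x e e0; have [k [m km]] := contraction_near n2 x (Num.max K M) e0.
  by exists (contraction R n2 k m) => //; exact: BS1_contraction.
- move=> g g' gBS g'BS; apply: matched_commute; last exact: mconj.
  by apply: matchedM; [apply: matchedM => //; exact: mconj|exact: matchedV].
Qed.
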